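(* Let $w^*=\frac{\gamma^+}{\gamma^++\gamma^-}$ and $p^*=\int_{[0,1]^2}w^*$. Fix $\delta\in(0,1-p^* )$, $\epsilon\in(0,T)$ and $t\in[0,T]$. Consider the variational problem: $$\text{minimize }\int_{[0,1]^2_T}\mathcal Q_1(\phi,\gamma^+,\gamma^-)\ \text{ over }\phi\in\mathcal W_0\ \text{ subject to }\ \frac1{|U_\epsilon(t)|}\int_{[0,1]^2\times U_\epsilon(t)}\phi\ \ge\ p^*+\delta.$$ There is a unique (up to a set of measure zero) optimizer $\phi^{*,t,\delta}$, given by $$\phi^{*,t,\delta}_s=\begin{cases}\dfrac12+\dfrac{\gamma^+-\gamma^-+\lambda_\delta}{2\sqrt{(\gamma^+-\gamma^-+\lambda_\delta)^2+4\gamma^+\gamma^-}}=:f^*_\delta,&s\in U_\epsilon(t),\\[2mm] w^*,&s\notin U_\epsilon(t),\end{cases}$$ where $\lambda_\delta\in\mathbb R$ is the unique solution of $$\int_{[0,1]^2}\left(\frac12+\frac{\gamma^+-\gamma^-+\lambda_\delta}{2\sqrt{(\gamma^+-\gamma^-+\lambda_\delta)^2+4\gamma^+\gamma^-}}\right)=p^*+\delta.$$ Moreover, $\lambda_\delta$ is strictly increasing and continuous in $\delta$. The optimal value of the objective function is $$|U_\epsilon(t)|\int_{[0,1]^2}\mathcal Q_1(f^*_\delta,\gamma^+,\gamma^-),$$ which is also continuous in $\delta$.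
   Context: $T\in(0,\infty)$, $[0,1]^2_T=[0,1]^2\times[0,T]$. $\gamma^+,\gamma^-:[0,1]^2\to[0,\infty)$ are measurable functions in $L^1([0,1]^2)$ with $\gamma^\pm\ge c_\beta$ a.e. for some constant $c_\beta>0$. $\mathcal W_0$ is the set of measurable $\phi:[0,1]^2\times[0,T]\to\mathbb R$ with $0\le\phi\le1$ a.e., with $\phi_s=\phi(\cdot,\cdot,s)$. $\mathcal Q_1(u,v^+,v^-)=\big(\sqrt{v^+(1-u)}-\sqrt{v^-u}\big)^2$ for $u\in[0,1]$, $v^\pm\ge0$; $\int_{[0,1]^2_T}\mathcal Q_1(\phi,\gamma^+,\gamma^-)$ means $\int_0^T\int_{[0,1]^2}\mathcal Q_1(\phi_s(x,y),\gamma^+(x,y),\gamma^-(x,y))\,dx\,dy\,ds$. $U_\epsilon(t)=[t-\epsilon,t+\epsilon]\cap[0,T]$ and $|U_\epsilon(t)|$ is its length. All integrals are with respect to Lebesgue measure. *)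

(* Defs.v *)
From HB Require Import structures.
From mathcomp Require Import all_boot all_order all_algebra.
From mathcomp Require Import all_classical all_reals all_analysis.
Set Implicit Arguments.
Unset Strict Implicit.
Unset Printing Implicit Defensive.
Import Order.TTheory GRing.Theory Num.Theory.
Import numFieldNormedType.Exports.
Local Open Scope classical_set_scope.
Local Open Scope ring_scope.

Notation leb1 R := (@lebesgue_measure R).

Lemma sigma_finite_prod d1 d2 (T1 : measurableType d1) (T2 : measurableType d2)
    (R : realType) (m1 : {sigma_finite_measure set T1 -> \bar R})
    (m2 : {sigma_finite_measure set T2 -> \bar R}) :
  sigma_finite setT (m1 \x m2)%E.
Proof.
have /sigma_finiteP[F [TF ndF Foo]] := sigma_finiteT m1.
have /sigma_finiteP[G [TG ndG Goo]] := sigma_finiteT m2.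
exists (fun n => F n `*` G n).
  rewrite -setXTT TF TG predeqE => -[x y]; split.
    move=> [/= [n _ Fnx] [k _ Gky]]; exists (maxn n k) => //; split.
    - by move: x Fnx; exact/subsetPset/ndF/leq_maxl.
    - by move: y Gky; exact/subsetPset/ndG/leq_maxr.
  by move=> [n _ []/= ? ?]; split; exists n.
move=> k; have [mF Fk] := Foo k; have [mG Gk] := Goo k.
split; first exact: measurableX.
by rewrite product_measure1E// lte_mul_pinfty// ge0_fin_numE.
Qed.

(* Named constants: for a bare m1 \x m2 the sigma-finite structure is not
   inferred, being shadowed by the one for probability measures. *)
Definition leb2 (R : realType) :
    set (measurableTypeR R * measurableTypeR R) -> \bar R :=
  (leb1 R \x leb1 R)%E.
HB.instance Definition _ (R : realType) := Measure.on (@leb2 R).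
HB.instance Definition _ (R : realType) :=
  Measure_isSigmaFinite.Build _ _ _ (@leb2 R)
    (sigma_finite_prod (leb1 R) (leb1 R)).

Definition leb3 (R : realType) :
    set (measurableTypeR R * measurableTypeR R * measurableTypeR R) ->
    \bar R :=
  (@leb2 R \x leb1 R)%E.
HB.instance Definition _ (R : realType) := Measure.on (@leb3 R).
HB.instance Definition _ (R : realType) :=
  Measure_isSigmaFinite.Build _ _ _ (@leb3 R)
    (sigma_finite_prod (@leb2 R) (leb1 R)).

Arguments leb2 : clear implicits.
Arguments leb3 : clear implicits.

Section VariationalProblem.
Variable R : realType.

Definition unit_square : set (R * R) := `[0, 1] `*` `[0, 1].

(* Points of [0,1]^2 x [0,T] are written ((x, y), s). *)
Definition space_time (T : R) : set (R * R * R) := unit_square `*` `[0, T].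

(* Functions on [0,1]^2 and on [0,1]^2 x [0,T] are total functions whose values
   outside of the domain are never used. *)
Definition W0 (T : R) (phi : R * R * R -> R) : Prop :=
  measurable_fun (space_time T) phi /\
  {ae leb3 R, forall q, space_time T q -> 0 <= phi q <= 1}.

Definition Q1 (u vp vm : R) : R :=
  (Num.sqrt (vp * (1 - u)) - Num.sqrt (vm * u)) ^+ 2.

Definition window (T eps t : R) : set R := `[t - eps, t + eps] `&` `[0, T].

Definition window_length (T eps t : R) : R := fine (leb1 R (window T eps t)).

Section Rates.
Variables gp gm : R * R -> R.

Definition wstar (z : R * R) : R := gp z / (gp z + gm z).

Definition pstar : R := \int[leb2 R]_(z in unit_square) wstar z.

Definition ftilt (lambda : R) (z : R * R) : R :=
  2^-1 + (gp z - gm z + lambda) /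
         (2 * Num.sqrt ((gp z - gm z + lambda) ^+ 2 + 4 * gp z * gm z)).

(* The objective takes values in the extended reals, so an infinite integral
   is not confused with a finite one. *)
Definition objective (T : R) (phi : R * R * R -> R) : \bar R :=
  (\int[leb1 R]_(s in `[0%R, T]) \int[leb2 R]_(z in unit_square)
     (Q1 (phi (z, s)) (gp z) (gm z))%:E)%E.

Definition feasible (T eps t delta : R) : set (R * R * R -> R) :=
  [set phi | W0 T phi /\
    pstar + delta <= (window_length T eps t)^-1 *
      \int[leb3 R]_(q in unit_square `*` window T eps t) phi q].

Definition is_optimizer (T eps t delta : R) (phi : R * R * R -> R) : Prop :=
  feasible T eps t delta phi /\
  forall psi, feasible T eps t delta psi ->
    (objective T phi <= objective T psi)%E.

Definition optimal_value (T eps t delta : R) : \bar R :=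
  ereal_inf [set objective T phi | phi in feasible T eps t delta].

Definition phistar (T eps t lambda : R) (q : R * R * R) : R :=
  if q.2 \in window T eps t then ftilt lambda q.1 else wstar q.1.

End Rates.
End VariationalProblem.

Arguments unit_square {R}.

(* Main.v *)
(* For fixed rates a, b > 0 the function u |-> Q1 u a b is strictly convex on
   [0, 1], with derivative l exactly at u = tilt a b l; completing a square
   turns the gap between Q1 and its tangent line of slope l into a multiple of
   (sqrt ((1 - f) u) - sqrt (f (1 - u)))^2, f = tilt a b l.  Everything follows
   from this tangent inequality.  Integrated over space-time with slope
   lambda >= 0 on the time window and slope 0 elsewhere (tilt a b 0 = wstar), it
   gives optimality of phistar, and its equality case gives uniqueness.  At
   u = 1 it reads l (1 - tilt a b l) <= b, so the integral of ftilt l tends to 1 as l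
   grows and lambda exists by the intermediate value theorem.  Between two tilts
   it bounds the increments of the value by those of delta times lambda, hence
   the continuity of the value. *)

Require Import Defs.
From HB Require Import structures.
From mathcomp Require Import all_boot all_order all_algebra.
From mathcomp Require Import ring lra.
From mathcomp Require Import all_classical all_reals all_analysis.
From mathcomp Require Import measurable_realfun.
Import Order.TTheory GRing.Theory Num.Theory.
Import numFieldNormedType.Exports.
Local Open Scope classical_set_scope.
Local Open Scope ring_scope.

Set Implicit Arguments.
Unset Strict Implicit.
Unset Printing Implicit Defensive.

(** * Pointwise calculus of [Q1] and of its tilted minimizer *)

Section Tilt.
Variable R : realType.
Implicit Types a b c l u : R.

(** [ftilt] at one point, with the two rates as numbers; [ftilt gp gm l z] is convertible to
    [tilt (gp z) (gm z) l]. *)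
Definition tilt a b l : R :=
  2^-1 + (a - b + l) / (2 * Num.sqrt ((a - b + l) ^+ 2 + 4 * a * b)).

Lemma norm_div_sqrt_le1 (m k : R) : 0 <= k -> `|m / Num.sqrt (m ^+ 2 + k)| <= 1.
Proof.
(* At [m = 0] the denominator may vanish, but the quotient is 0 in any case. *)
move=> k0; have [->|m0] := eqVneq m 0; first by rewrite mul0r normr0.
have mk : 0 < m ^+ 2 + k by rewrite ltr_pwDl// exprn_even_gt0.
rewrite normrM normfV [X in _ / X]ger0_norm ?sqrtr_ge0 //.
by rewrite ler_pdivrMr ?sqrtr_gt0 // mul1r -sqrtr_sqr ler_wsqrtr // lerDl.
Qed.

Lemma tiltE a b l : tilt a b l =
  (1 + (a - b + l) / Num.sqrt ((a - b + l) ^+ 2 + 4 * a * b)) / 2.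
Proof. by rewrite /tilt invfM; ring. Qed.

(** Stated for nonnegative rates so as to apply at every point of the square; positivity of the
    rates holds only almost everywhere. *)
Lemma tilt_itv a b l : 0 <= a -> 0 <= b -> 0 <= tilt a b l <= 1.
Proof.
move=> a0 b0; rewrite tiltE.
have /(@norm_div_sqrt_le1 (a - b + l)) : 0 <= 4 * a * b by rewrite !mulr_ge0.
by rewrite ler_norml => /andP[] *; apply/andP; split; lra.
Qed.

Lemma tilt0 a b : 0 < a -> 0 < b -> tilt a b 0 = a / (a + b).
Proof.
move=> a0 b0; have ab : 0 < a + b by rewrite addr_gt0.
rewrite tiltE addr0 (_ : _ + 4 * a * b = (a + b) ^+ 2); last by ring.
by rewrite sqrtr_sqr gtr0_norm //; field; rewrite gt_eqF.
Qed.

Lemma Q1_ge0 u a b : 0 <= Q1 u a b.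
Proof. exact: sqr_ge0. Qed.

(** Expanding the square isolates the only nonlinear term, a multiple of the concave function sqrt
    (u (1 - u)). *)
Lemma Q1E u a b : 0 <= a -> 0 <= b -> 0 <= u <= 1 ->
  Q1 u a b = a * (1 - u) + b * u - 2 * Num.sqrt (a * b) * Num.sqrt (u * (1 - u)).
Proof.
move=> a0 b0 /andP[u0 u1]; have v0 : 0 <= 1 - u by lra.
rewrite /Q1 sqrrB !sqr_sqrtr ?mulr_ge0 // !sqrtrM //.
by ring.
Qed.

(** Supplies the integrable majorant [gp + gm] of the cost. *)
Lemma Q1_le u a b : 0 <= a -> 0 <= b -> 0 <= u <= 1 -> Q1 u a b <= a + b.
Proof.
move=> a0 b0 u01; rewrite Q1E //; case/andP: u01 => u0 u1.
have : 0 <= 2 * Num.sqrt (a * b) * Num.sqrt (u * (1 - u)).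
  by rewrite !mulr_ge0 ?sqrtr_ge0.
by nra.
Qed.

(* Since [tilt a b l] is the point at which the derivative of [Q1] is [l], the
   left-hand side is the gap between [Q1] and its tangent line of slope [l]. *)
Lemma Q1_tangent_gap a b l u (f := tilt a b l) : 0 < a -> 0 < b -> 0 <= u <= 1 ->
  Q1 u a b - (Q1 f a b + l * (u - f)) =
  Num.sqrt ((a - b + l) ^+ 2 + 4 * a * b) *
    (Num.sqrt ((1 - f) * u) - Num.sqrt (f * (1 - u))) ^+ 2.
Proof.
move=> a0 b0 u01.
have [a0' b0'] := (ltW a0, ltW b0).
have f01 : 0 <= f <= 1 by exact: tilt_itv.
rewrite (Q1E a0' b0' u01) (Q1E a0' b0' f01).
rewrite sqrrB !sqr_sqrtr ?mulr_ge0; try by case/andP: f01; case/andP: u01; lra.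
set s := Num.sqrt (_ + _); set m := a - b + l.
have s0 : 0 < s.
  by rewrite sqrtr_gt0 ltr_wpDl ?sqr_ge0 // !mulr_gt0.
have s2 : s ^+ 2 = m ^+ 2 + 4 * a * b.
  by rewrite sqr_sqrtr // addr_ge0 ?sqr_ge0 // ltW // !mulr_gt0.
have fE : f = (1 + m / s) / 2 by rewrite /f tiltE.
(* From f = (1 + m / s) / 2, f (1 - f) = (s^2 - m^2) / (4 s^2), and s^2 - m^2 = 4ab. *)
have ffE : Num.sqrt (f * (1 - f)) = Num.sqrt (a * b) / s.
  rewrite -[in RHS](ger0_norm (ltW s0)) -sqrtr_sqr -sqrtrV ?sqr_ge0 // -sqrtrM ?mulr_ge0 ?ltW //.
  congr Num.sqrt; rewrite fE.
  apply: (@mulIf _ (s ^+ 2)); first by rewrite expf_neq0 ?gt_eqF.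
  rewrite mulfVK ?expf_neq0 ?gt_eqF //.
  have -> : (1 + m / s) / 2 * (1 - (1 + m / s) / 2) * s ^+ 2 = (s ^+ 2 - m ^+ 2) / 4.
    by field; rewrite gt_eqF.
  by rewrite s2; field.
(* The cross term of the square regroups as sqrt (f (1 - f)) sqrt (u (1 - u)), which matches the
   radical in [Q1 u a b]. *)
have -> : Num.sqrt ((1 - f) * u) * Num.sqrt (f * (1 - u)) =
    Num.sqrt (a * b) / s * Num.sqrt (u * (1 - u)).
  rewrite -ffE -!sqrtrM ?mulr_ge0; try by case/andP: f01; case/andP: u01; lra.
  by congr Num.sqrt; ring.
rewrite ffE.
set A := Num.sqrt (a * b); set B := Num.sqrt _.
have AA : A * A = a * b by rewrite -expr2 sqr_sqrtr // mulr_ge0 ?ltW.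
have -> : 2 * A * (A / s) = (s ^+ 2 - m ^+ 2) / (2 * s).
  by rewrite mulrA -[2 * A * A]mulrA AA s2; field; rewrite gt_eqF.
rewrite fE; have -> : l = m - a + b by rewrite /m; ring.
by field; rewrite gt_eqF.
Qed.

Lemma Q1_tangent a b l u (f := tilt a b l) : 0 < a -> 0 < b -> 0 <= u <= 1 ->
  Q1 f a b + l * (u - f) <= Q1 u a b.
Proof.
move=> a0 b0 u01; rewrite -subr_ge0 Q1_tangent_gap //.
by rewrite mulr_ge0 ?sqrtr_ge0 ?sqr_ge0.
Qed.

(** The prefactor of the gap is positive, so a zero gap forces (1 - f) u = f (1 - u), that is u =
    f. *)
Lemma Q1_tangent_eq a b l u (f := tilt a b l) : 0 < a -> 0 < b -> 0 <= u <= 1 ->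
  Q1 u a b = Q1 f a b + l * (u - f) -> u = f.
Proof.
move=> a0 b0 u01 /eqP; rewrite -subr_eq0 Q1_tangent_gap // mulf_eq0.
have f01 : 0 <= f <= 1 by apply: tilt_itv; exact: ltW.
case/andP: f01 => f0 f1; case/andP: u01 => u0 u1.
rewrite gt_eqF /= ?sqrtr_gt0 ?ltr_wpDl ?sqr_ge0 ?mulr_gt0 //.
rewrite sqrf_eq0 subr_eq0 eqr_sqrt ?mulr_ge0 ?subr_ge0 // => /eqP; rewrite -/f; lra.
Qed.

(** Adding the tangent inequalities of the two tilts at each other gives (l2 - l1) (f2 - f1) >= 0.
    Equality f1 = f2 is excluded since (m / s)^2 = 1 - 4ab / s^2 then gives equal s, hence equal
    m. *)
Lemma tilt_lt a b l1 l2 : 0 < a -> 0 < b -> l1 < l2 -> tilt a b l1 < tilt a b l2.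
Proof.
move=> a0 b0 l12; have [a0' b0'] := (ltW a0, ltW b0).
have f1 := tilt_itv l1 a0' b0'; have f2 := tilt_itv l2 a0' b0'.
have t1 := Q1_tangent l1 a0 b0 f2; have t2 := Q1_tangent l2 a0 b0 f1.
have [//|h|e] := ltgtP (tilt a b l1) (tilt a b l2); first by nra.
have K0 : 0 < 4 * a * b by rewrite !mulr_gt0.
move: e; rewrite !tiltE.
set m1 := a - b + l1; set m2 := a - b + l2.
set s1 := Num.sqrt _; set s2 := Num.sqrt _ => e.
have mk m : 0 < m ^+ 2 + 4 * a * b by rewrite ltr_wpDl ?sqr_ge0.
have s10 : 0 < s1 by rewrite sqrtr_gt0.
have s20 : 0 < s2 by rewrite sqrtr_gt0.
have s1E : s1 ^+ 2 = m1 ^+ 2 + 4 * a * b by rewrite sqr_sqrtr // ltW.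
have s2E : s2 ^+ 2 = m2 ^+ 2 + 4 * a * b by rewrite sqr_sqrtr // ltW.
have {}e : m1 / s1 = m2 / s2 by lra.
have : (m1 / s1) ^+ 2 = (m2 / s2) ^+ 2 by rewrite e.
have q1 : (m1 / s1) ^+ 2 = 1 - 4 * a * b / s1 ^+ 2.
  by rewrite expr_div_n -[m1 ^+ 2](addrK (4 * a * b)) -s1E; field; rewrite gt_eqF.
have q2 : (m2 / s2) ^+ 2 = 1 - 4 * a * b / s2 ^+ 2.
  by rewrite expr_div_n -[m2 ^+ 2](addrK (4 * a * b)) -s2E; field; rewrite gt_eqF.
rewrite q1 q2 => /addrI/oppr_inj/(mulfI (lt0r_neq0 K0))/invr_inj/eqP.
rewrite eqrXn2 ?ltW // => /eqP s12; move: e; rewrite s12.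
by move/(mulIf (invr_neq0 (lt0r_neq0 s20))); rewrite /m1 /m2; lra.
Qed.

(* The tangent inequality at [u = 1]. *)
Lemma tilt_onem_le a b l : 0 < a -> 0 < b -> l * (1 - tilt a b l) <= b.
Proof.
move=> a0 b0; have u01 : 0 <= (1 : R) <= 1 by rewrite ler01 lexx.
have := Q1_tangent l a0 b0 u01; rewrite (Q1E (ltW a0) (ltW b0) u01).
rewrite subrr !mulr0 sqrtr0 mulr0 mulr1 add0r subr0.
by have := Q1_ge0 (tilt a b l) a b; lra.
Qed.

(** The root s is at least 2c, dominates |m| and is 1-Lipschitz in m; these three facts bound the
    increment of m / s. *)
Lemma tilt_lipschitz a b c l1 l2 : 0 < c -> c <= a -> c <= b ->
  `|tilt a b l1 - tilt a b l2| <= `|l1 - l2| / c.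
Proof.
move=> c0 ca cb; have [a0 b0] := (lt_le_trans c0 ca, lt_le_trans c0 cb).
have K0 : 0 < 4 * a * b by rewrite !mulr_gt0.
rewrite !tiltE; set m1 := a - b + l1; set m2 := a - b + l2.
set s1 := Num.sqrt _; set s2 := Num.sqrt _.
have mk m : 0 < m ^+ 2 + 4 * a * b by rewrite ltr_wpDl ?sqr_ge0.
have s10 : 0 < s1 by rewrite sqrtr_gt0.
have s20 : 0 < s2 by rewrite sqrtr_gt0.
have s1E : s1 ^+ 2 = m1 ^+ 2 + 4 * a * b by rewrite sqr_sqrtr // ltW.
have s2E : s2 ^+ 2 = m2 ^+ 2 + 4 * a * b by rewrite sqr_sqrtr // ltW.
have cab := ler_pM (ltW c0) (ltW c0) ca cb.
have [s10' s20' c2] : [/\ 0 <= s1, 0 <= s2 & 0 <= 2 * c] by split; lra.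
have cs1 : 2 * c <= s1.
  by rewrite -ler_sqr ?nnegrE // s1E; have := sqr_ge0 m1; lra.
have m2s2 : `|m2| <= s2.
  by rewrite -ler_sqr ?nnegrE // s2E real_normK ?num_real // lerDl ltW.
have m1s1 : `|m1| <= s1.
  by rewrite -ler_sqr ?nnegrE // s1E real_normK ?num_real // lerDl ltW.
have lm : l1 - l2 = m1 - m2 by rewrite /m1 /m2; ring.
(* Differences of squares: (s2 - s1) (s2 + s1) = (m2 - m1) (m2 + m1), and |m2 + m1| <= s2 + s1. *)
have ds : `|s2 - s1| <= `|m1 - m2|.
  have e : `|s2 - s1| * (s2 + s1) = `|m1 - m2| * `|m2 + m1|.
    rewrite -[s2 + s1]gtr0_norm ?addr_gt0 // -!normrM -[RHS]normrN; congr `|_|.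
    by rewrite -subr_sqr s1E s2E; ring.
  rewrite -(ler_pM2r (addr_gt0 s20 s10)) e ler_wpM2l //.
  by apply: (le_trans (ler_normD _ _)); exact: lerD.
have -> : (1 + m1 / s1) / 2 - (1 + m2 / s2) / 2 =
    ((m1 - m2) * s2 + m2 * (s2 - s1)) / (2 * s1 * s2).
  by field; rewrite !gt_eqF.
rewrite normrM normfV (gtr0_norm (mulr_gt0 (mulr_gt0 _ _) _)) // lm.
rewrite ler_pdivrMr ?mulr_gt0 // mulrAC ler_pdivlMr //.
apply: (@le_trans _ _ (2 * `|m1 - m2| * s2 * c)).
  rewrite ler_wpM2r ?(ltW c0) //; apply: (le_trans (ler_normD _ _)).
  rewrite !normrM (gtr0_norm s20).
  have := ler_pM (normr_ge0 _) (normr_ge0 _) m2s2 ds.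
  by have := mulr_ge0 (normr_ge0 (m1 - m2)) (ltW s20); lra.
have := mulr_ge0 (normr_ge0 (m1 - m2)) (ltW s20); nra.
Qed.

End Tilt.

(** * Comparison of integrals from almost-everywhere relations *)

Section AlmostEverywhere.
Context d (X : measurableType d) (R : realType).
Variable mu : {measure set X -> \bar R}.
Variables (D : set X) (mD : measurable D).
Implicit Types f g : X -> R.

Lemma ae_le_integrable f g : measurable_fun D f ->
  {ae mu, forall x, D x -> `|f x| <= g x} ->
  mu.-integrable D (EFin \o g) -> mu.-integrable D (EFin \o f).
Proof.
move=> mf fg /integrableP[mg ig]; apply/integrableP; split.
  exact/measurable_EFinP.
apply: le_lt_trans ig; apply: ae_ge0_le_integral => //.
- by apply: measurableT_comp => //; exact/measurable_EFinP.
- exact: measurableT_comp.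
- by apply: filterS fg => x h Dx; rewrite /= lee_fin ler_normr h.
Qed.

Lemma ae_eq_Rintegral f g : measurable_fun D f -> measurable_fun D g ->
  ae_eq mu D f g -> \int[mu]_(x in D) f x = \int[mu]_(x in D) g x.
Proof.
move=> mf mg fg; congr fine; apply: ae_eq_integral => //.
- exact/measurable_EFinP.
- exact/measurable_EFinP.
- by apply: filterS fg => x h /h ->.
Qed.

(** The difference [g - f] agrees almost everywhere with its absolute value, whose integral is
    nonnegative. *)
Lemma ae_le_Rintegral f g :
  mu.-integrable D (EFin \o f) -> mu.-integrable D (EFin \o g) ->
  {ae mu, forall x, D x -> f x <= g x} ->
  \int[mu]_(x in D) f x <= \int[mu]_(x in D) g x.
Proof.
move=> fi gi fg; rewrite -subr_ge0 -RintegralB //.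
have mgf : measurable_fun D (fun x => g x - f x).
  by apply: measurable_funB; apply/measurable_EFinP;
    [case/integrableP: gi|case/integrableP: fi].
rewrite (@ae_eq_Rintegral _ (fun x => `|g x - f x|)) //.
- exact: Rintegral_ge0.
- exact: measurableT_comp.
- by apply: filterS fg => x h Dx; rewrite ger0_norm // subr_ge0 h.
Qed.

(** An almost everywhere nonnegative function with zero integral vanishes almost everywhere. This
    turns equality of integrals into uniqueness. *)
Lemma ae_eq_of_Rintegral_le f g :
  mu.-integrable D (EFin \o f) -> mu.-integrable D (EFin \o g) ->
  {ae mu, forall x, D x -> f x <= g x} ->
  \int[mu]_(x in D) g x <= \int[mu]_(x in D) f x -> ae_eq mu D f g.
Proof.
move=> fi gi fg gf.
have mgf : measurable_fun D (fun x => g x - f x).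
  by apply: measurable_funB; apply/measurable_EFinP;
    [case/integrableP: gi|case/integrableP: fi].
have : \int[mu]_(x in D) (g x - f x) = 0.
  by rewrite RintegralB //; apply/eqP; rewrite subr_eq0 eq_le gf ae_le_Rintegral.
rewrite (@ae_eq_Rintegral _ (fun x => `|g x - f x|)) //; last 2 first.
- exact: measurableT_comp.
- by apply: filterS fg => x h Dx; rewrite ger0_norm // subr_ge0 h.
have gfi : mu.-integrable D (EFin \o (fun x => g x - f x)) by exact: (integrableB mD gi fi).
have mgfE : measurable_fun D (EFin \o (fun x => g x - f x)) by exact/measurable_EFinP.
move=> int0; have : (\int[mu]_(x in D) `|(EFin \o (fun x => g x - f x)%R) x| = 0)%E.
  rewrite -[LHS]fineK; last by apply: integrable_fin_num => //; exact: (integrable_norm gfi).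
  by congr EFin.
move/(ae_eq_integral_abs mu mD mgfE); apply: filterS => x /= e /e [/eqP].
by rewrite subr_eq0 => /eqP ->.
Qed.

End AlmostEverywhere.

(** * Null sets and integrals on product spaces *)

Section Product.
Context d1 d2 (X : measurableType d1) (Y : measurableType d2) (R : realType).
Variable m1 : {sigma_finite_measure set X -> \bar R}.
Variable m2 : {sigma_finite_measure set Y -> \bar R}.

(** The cylinder over a null set is null, even over a factor of infinite measure, since 0 times
    infinity is 0. *)
Lemma ae_product_fst (P : X -> Prop) :
  {ae m1, forall x, P x} -> {ae (m1 \x m2)%E, forall q, P q.1}.
Proof.
move=> [N [mN N0 PN]]; exists (N `*` setT); split.
- exact: measurableX.
- by rewrite product_measure1E // [X in (X * _)%E](_ : _ = 0%E) ?mul0e.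
- by move=> q /PN.
Qed.

(** Extension by zero outside the rectangle reduces this to Tonelli on the whole space. The order of
    integration is that of [objective]. *)
Lemma Tonelli_setX (A : set X) (B : set Y) (F : X * Y -> R) :
  measurable A -> measurable B -> measurable_fun (A `*` B) F ->
  (forall q, 0 <= F q) ->
  (\int[m2]_(y in B) \int[m1]_(x in A) (F (x, y))%:E =
   \int[m1 \x m2]_(q in A `*` B) (F q)%:E)%E.
Proof.
move=> mA mB mF F0; have mAB : measurable (A `*` B) by exact: measurableX.
rewrite [RHS]integral_mkcond fubini_tonelli2; last 2 first.
- by apply/(measurable_restrictT _ mAB)/measurable_EFinP.
- by move=> q; rewrite patchE; case: ifP; rewrite ?lee_fin.
rewrite integral_mkcond; apply: eq_integral => y _.
rewrite patchE /fubini_G; case: ifPn => yB.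
  rewrite [LHS]integral_mkcond; apply: eq_integral => x _.
  by rewrite !patchE in_setX /= yB andbT.
rewrite integral0_eq // => x _.
by rewrite patchE in_setX /= (negbTE yB) andbF.
Qed.

Lemma measurable_fun_setX_fst (A : set X) (B : set Y) (f : X -> R) :
  measurable A -> measurable B -> measurable_fun A f ->
  measurable_fun (A `*` B) (f \o fst).
Proof.
move=> mA mB mf; apply: (measurable_comp mA) mf _.
  by move=> _ [q [Aq _] <-].
exact: measurable_funTS.
Qed.

Lemma integral_setX_fst (A : set X) (B : set Y) (f : X -> R) :
  measurable A -> measurable B -> measurable_fun A f ->
  (forall x, A x -> 0 <= f x) ->
  (\int[m1 \x m2]_(q in A `*` B) (f q.1)%:E =
   (\int[m1]_(x in A) (f x)%:E) * m2 B)%E.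
Proof.
move=> mA mB mf f0; rewrite -integral_cst //.
(* [Tonelli_setX] asks for nonnegativity everywhere, while [f] has it on [A] only; hence the
   absolute value. *)
rewrite (eq_integral (fun q => `|f q.1|%:E)); last first.
  by move=> q /set_mem[Aq _]; rewrite ger0_norm ?f0.
have mF : measurable_fun (A `*` B) (fun q => `|f q.1|).
  by apply: measurableT_comp => //; exact: measurable_fun_setX_fst.
apply: (etrans (esym (Tonelli_setX mA mB mF (fun q => normr_ge0 _)))).
apply: eq_integral => y _; apply: eq_integral => x /set_mem Ax.
by rewrite ger0_norm ?f0.
Qed.

Lemma integrable_setX_fst (A : set X) (B : set Y) (f : X -> R) :
  measurable A -> measurable B -> (m2 B < +oo)%E ->
  m1.-integrable A (EFin \o f) ->
  (m1 \x m2)%E.-integrable (A `*` B) (EFin \o (f \o fst)).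
Proof.
move=> mA mB Boo /integrableP[/measurable_EFinP mf foo]; apply/integrableP; split.
  by apply/measurable_EFinP; exact: measurable_fun_setX_fst.
rewrite (integral_setX_fst (f := fun x => `|f x|)) //; last exact: measurableT_comp.
by rewrite lte_mul_pinfty ?integral_ge0 // ge0_fin_numE ?integral_ge0.
Qed.

End Product.

(** * Measurability of the real functions involved *)

Section MeasurableReal.
Context d (X : measurableType d) (R : realType).
Implicit Types (D : set X) (f g : X -> R).

Lemma measurable_fun_sqrt D f :
  measurable_fun D f -> measurable_fun D (fun x => Num.sqrt (f x)).
Proof.
by apply: measurableT_comp; apply: continuous_measurable_fun; exact: sqrt_continuous.
Qed.

(* For [0 <= y], including the junk value at 0, [y^-1 = y `^ (-1)]. *)
Lemma measurable_fun_div_ge0 D f g : (forall x, D x -> 0 <= g x) ->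
  measurable_fun D f -> measurable_fun D g -> measurable_fun D (fun x => f x / g x).
Proof.
move=> g0 mf mg; apply: measurable_funM => //.
apply: (eq_measurable_fun (fun x => g x `^ (-1))).
  by move=> x /[!inE] /g0 /powR_inv1 ->.
by apply: (measurableT_comp (@measurable_powR R (-1))).
Qed.

Lemma measurable_fun_Q1 D u f g : measurable_fun D u -> measurable_fun D f ->
  measurable_fun D g -> measurable_fun D (fun x => Q1 (u x) (f x) (g x)).
Proof.
move=> mu mf mg; apply: measurable_funX; apply: measurable_funB;
  apply: measurable_fun_sqrt; apply: measurable_funM => //.
exact: measurable_funB.
Qed.

Lemma measurable_fun_tilt D f g h : measurable_fun D f -> measurable_fun D g ->
  measurable_fun D h -> measurable_fun D (fun x => tilt (f x) (g x) (h x)).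
Proof.
move=> mf mg mh.
have mm : measurable_fun D (fun x => f x - g x + h x).
  by apply: measurable_funD => //; exact: measurable_funB.
apply: measurable_funD; [exact: measurable_cst|apply: measurable_fun_div_ge0 => //].
apply: measurable_funM => //; apply: measurable_fun_sqrt.
apply: measurable_funD; first exact: measurable_funX.
by apply: measurable_funM => //; exact: measurable_funM.
Qed.

End MeasurableReal.

(** Converts the two tangent inequalities between two points of a convex curve, with slopes in
    [0, k], into a Lipschitz bound. *)
Lemma norm_le_chord (R : realFieldType) (u v l m k d : R) : 0 <= l <= k -> 0 <= m <= k ->
  m * d <= u - v <= l * d -> `|u - v| <= `|d| * k.
Proof.
move=> /andP[l0 lk] /andP[m0 mk] /andP[h1 h2].
have n1 := ler_norm d; have n2 : - d <= `|d| by rewrite -normrN ler_norm.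
have p1 : l * d <= l * `|d| by exact: ler_wpM2l.
have p2 : - (m * `|d|) <= m * d by rewrite -mulrN ler_wpM2l // lerNl.
have p3 := ler_wpM2l (normr_ge0 d) lk; have p4 := ler_wpM2l (normr_ge0 d) mk.
by rewrite ler_norml; apply/andP; split; lra.
Qed.

(** * Lebesgue measure on the unit square *)

Lemma measurable_unit_square (R : realType) :
  measurable (unit_square : set (measurableTypeR R * measurableTypeR R)).
Proof. by apply: measurableX; exact: measurable_itv. Qed.

Lemma leb2_unit_square (R : realType) : leb2 R unit_square = 1%E.
Proof.
rewrite /leb2 /unit_square product_measure1E; [|exact: measurable_itv..].
by rewrite /= lebesgue_measure_itv /= lte01 oppr0 adde0 mule1.
Qed.

(* The library's hint for [Filter] does not fire on the named constants [leb2]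
   and [leb3]. *)
#[local] Instance leb2_ae_filter (R : realType) :
  Filter (nbhs (almost_everywhere (leb2 R))).
Proof. exact: ae_filter_ringOfSetsType. Qed.

#[local] Instance leb3_ae_filter (R : realType) :
  Filter (nbhs (almost_everywhere (leb3 R))).
Proof. exact: ae_filter_ringOfSetsType. Qed.

#[local] Hint Extern 0 (measurable unit_square) =>
  (exact: measurable_unit_square) : core.

(** * Mass and cost of the tilted profiles on the square *)

Section Rates.
Variables (R : realType) (gp gm : R * R -> R).
Hypothesis gp_ge0 : forall z, unit_square z -> 0 <= gp z.
Hypothesis gm_ge0 : forall z, unit_square z -> 0 <= gm z.
Hypothesis gp_meas : measurable_fun unit_square gp.
Hypothesis gm_meas : measurable_fun unit_square gm.
Hypothesis gp_L1 : (leb2 R).-integrable unit_square (EFin \o gp).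
Hypothesis gm_L1 : (leb2 R).-integrable unit_square (EFin \o gm).
Variable c : R.
Hypothesis hc : 0 < c.
Hypothesis gp_ge : {ae leb2 R, forall z, unit_square z -> c <= gp z}.
Hypothesis gm_ge : {ae leb2 R, forall z, unit_square z -> c <= gm z}.

(** The left-hand side of the equation for the multiplier; [ftilt_cost] is the optimal cost per unit
    of window length. *)
Definition ftilt_mass l := \int[leb2 R]_(z in unit_square) ftilt gp gm l z.
Definition ftilt_cost l := \int[leb2 R]_(z in unit_square) Q1 (ftilt gp gm l z) (gp z) (gm z).

Lemma rates_gt0 :
  {ae leb2 R, forall z, unit_square z -> 0 < gp z /\ 0 < gm z}.
Proof.
by apply: filterS2 gp_ge gm_ge => z h h' sz; split; apply: lt_le_trans hc _; auto.
Qed.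

Lemma ftilt_itv l z : unit_square z -> 0 <= ftilt gp gm l z <= 1.
Proof. by move=> sz; apply: tilt_itv; [exact: gp_ge0|exact: gm_ge0]. Qed.

Lemma measurable_ftilt l : measurable_fun unit_square (ftilt gp gm l).
Proof. exact: measurable_fun_tilt. Qed.

Lemma measurable_wstar : measurable_fun unit_square (wstar gp gm).
Proof.
apply: measurable_fun_div_ge0 => //; last exact: measurable_funD.
by move=> z sz; rewrite addr_ge0 ?gp_ge0 ?gm_ge0.
Qed.

Lemma integrable_cst_square r :
  (leb2 R).-integrable unit_square (EFin \o (cst r : R * R -> R)).
Proof.
apply: measurable_bounded_integrable => //.
  by rewrite [X in (X < _)%E](leb2_unit_square R) ltry.
by exists `|r|; split; rewrite ?num_real // => x /ltW h z _ /=.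
Qed.

Lemma integrable_ftilt l :
  (leb2 R).-integrable unit_square (EFin \o ftilt gp gm l).
Proof.
apply: ae_le_integrable (integrable_cst_square 1) => //.
  exact: measurable_ftilt.
by apply: aeW => z /(ftilt_itv l)/andP[h0 h1]; rewrite ger0_norm.
Qed.

Lemma integrable_Q1 (u : R * R -> R) : measurable_fun unit_square u ->
  {ae leb2 R, forall z, unit_square z -> 0 <= u z <= 1} ->
  (leb2 R).-integrable unit_square (EFin \o (fun z => Q1 (u z) (gp z) (gm z))).
Proof.
move=> mu u01; apply: ae_le_integrable (integrableD _ gp_L1 gm_L1) => //.
  exact: measurable_fun_Q1.
apply: filterS u01 => z h sz; rewrite ger0_norm ?Q1_ge0 // Q1_le //.
- exact: gp_ge0.
- exact: gm_ge0.
- exact: h.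
Qed.

Lemma integrable_Q1_ftilt l : (leb2 R).-integrable unit_square
  (EFin \o (fun z => Q1 (ftilt gp gm l z) (gp z) (gm z))).
Proof.
apply: integrable_Q1; first exact: measurable_ftilt.
by apply: aeW => z; exact: ftilt_itv.
Qed.

(** Multiplier 0 corresponds to [delta = 0], so that a positive [delta] has a positive
    multiplier. *)
Lemma mass0 : ftilt_mass 0 = pstar gp gm.
Proof.
apply: ae_eq_Rintegral => //.
- exact: measurable_ftilt.
- exact: measurable_wstar.
- by apply: filterS rates_gt0 => z h /h[a0 b0]; exact: tilt0.
Qed.

Lemma Rintegral_cst_square r : \int[leb2 R]_(z in unit_square) r = r.
Proof.
rewrite Rintegral_cst //.
by rewrite [X in fine X](leb2_unit_square R) mulr1.
Qed.

(** Otherwise the two ordered tilts would agree almost everywhere while differing almost everywhere,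
    and the square, of measure 1, would be null. *)
Lemma mass_lt l1 l2 : l1 < l2 -> ftilt_mass l1 < ftilt_mass l2.
Proof.
move=> l12; rewrite ltNge; apply/negP => m21.
have lt12 : {ae leb2 R, forall z, unit_square z ->
    ftilt gp gm l1 z < ftilt gp gm l2 z}.
  by apply: filterS rates_gt0 => z h /h[a0 b0]; exact: tilt_lt.
have le12 : {ae leb2 R, forall z, unit_square z ->
    ftilt gp gm l1 z <= ftilt gp gm l2 z}.
  by apply: filterS lt12 => z h /h /ltW.
have eq12 := ae_eq_of_Rintegral_le (@measurable_unit_square R)
  (integrable_ftilt l1) (integrable_ftilt l2) le12 m21.
have : {ae leb2 R, forall z, ~ unit_square z}.
  by apply: filterS2 eq12 lt12 => z e lt sz; move: (lt sz); rewrite e // ltxx.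
move=> [N [mN N0 sqN]].
have sqN' : unit_square `<=` N by move=> z sz; apply: sqN => /=; apply.
have /eqP := subset_measure0 (@measurable_unit_square R) mN sqN' N0.
by rewrite [X in X == _](leb2_unit_square R) onee_eq0.
Qed.

Lemma mass_le l1 l2 : l1 <= l2 -> ftilt_mass l1 <= ftilt_mass l2.
Proof. by rewrite le_eqVlt => /predU1P[->//|/mass_lt/ltW]. Qed.

Lemma mass_lipschitz l1 l2 : `|ftilt_mass l1 - ftilt_mass l2| <= `|l1 - l2| / c.
Proof.
have [i1 i2] := (integrable_ftilt l1, integrable_ftilt l2).
have i12 : (leb2 R).-integrable unit_square
    (EFin \o (fun z => ftilt gp gm l1 z - ftilt gp gm l2 z)).
  exact: (integrableB _ i1 i2).
rewrite /ftilt_mass -RintegralB // (le_trans (le_normr_Rintegral _ _)) //.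
rewrite -[leRHS]Rintegral_cst_square; apply: ae_le_Rintegral => //.
- exact: (integrable_norm i12).
- exact: integrable_cst_square.
- apply: filterS2 gp_ge gm_ge => z + + sz => /(_ sz) h /(_ sz) h'.
  exact: tilt_lipschitz.
Qed.

Lemma mass_continuous : continuous ftilt_mass.
Proof.
move=> l; apply/cvgrPdist_le => e e0.
have ec : 0 < e * c by rewrite mulr_gt0.
near=> l'; apply: (le_trans (mass_lipschitz _ _)).
rewrite ler_pdivrMr //; near: l'.
Unshelve. all: by end_near. Qed.

Lemma mass_onem_le l : l * (1 - ftilt_mass l) <= \int[leb2 R]_(z in unit_square) gm z.
Proof.
have i1 : (leb2 R).-integrable unit_square
    (EFin \o (fun z => 1 - ftilt gp gm l z)).
  exact: (integrableB _ (integrable_cst_square 1) (integrable_ftilt l)).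
rewrite -{1}[1]Rintegral_cst_square /ftilt_mass.
rewrite -RintegralB //; last 2 first.
- exact: integrable_cst_square.
- exact: integrable_ftilt.
rewrite -RintegralZl //; apply: ae_le_Rintegral => //.
- exact: (integrableZl _ l i1).
- by apply: filterS rates_gt0 => z h /h[a0 b0]; exact: tilt_onem_le.
Qed.

Lemma mass_surj y : pstar gp gm < y < 1 -> exists l, ftilt_mass l = y.
Proof.
move=> /andP[py y1]; set B := \int[leb2 R]_(z in unit_square) gm z.
have B0 : 0 <= B by apply: Rintegral_ge0.
(* Chosen so that M (1 - y) = B + (1 - y) > B; by [mass_onem_le] the mass at [M] cannot then lie
   below [y]. *)
pose M := B / (1 - y) + 1.
have M0 : 0 < M by rewrite ltr_pwDr // divr_ge0 // subr_ge0 ltW.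
have yM : y <= ftilt_mass M.
  have := mass_onem_le M; rewrite -/B => h.
  rewrite -subr_ge0 leNgt; apply/negP => h'.
  have : M * (1 - y) < M * (1 - ftilt_mass M) by rewrite ltr_pM2l //; lra.
  have -> : M * (1 - y) = B + (1 - y) by rewrite /M; field; lra.
  lra.
have p0 : ftilt_mass 0 <= y by rewrite mass0 ltW.
have [||l _ ly] := @IVT R ftilt_mass 0 M y (ltW M0).
- by apply: continuous_subspaceT => x; exact: mass_continuous.
- by rewrite ge_min le_max p0 yM orbT.
by exists l.
Qed.

(** The tangent inequality of slope [l1] at u = [ftilt l2], integrated: the multiplier is a
    subgradient of the cost as a function of the mass. *)
Lemma cost_tangent l1 l2 :
  l1 * (ftilt_mass l2 - ftilt_mass l1) <= ftilt_cost l2 - ftilt_cost l1.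
Proof.
rewrite lerBrDl.
have [i1 i2] := (integrable_ftilt l1, integrable_ftilt l2).
have i12 : (leb2 R).-integrable unit_square
    (EFin \o (fun z => ftilt gp gm l2 z - ftilt gp gm l1 z)).
  exact: (integrableB _ i2 i1).
have i12' : (leb2 R).-integrable unit_square
    (EFin \o (fun z => l1 * (ftilt gp gm l2 z - ftilt gp gm l1 z))).
  exact: (integrableZl _ l1 i12).
rewrite /ftilt_mass -RintegralB // -RintegralZl // /ftilt_cost -RintegralD //; last first.
  exact: integrable_Q1_ftilt.
apply: ae_le_Rintegral => //.
- exact: (integrableD _ (integrable_Q1_ftilt l1) i12').
- exact: integrable_Q1_ftilt.
- apply: filterS rates_gt0 => z h sz; have [a0 b0] := h sz.
  by apply: Q1_tangent => //; exact: ftilt_itv.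
Qed.

Lemma mass_lt_inv l1 l2 : ftilt_mass l1 < ftilt_mass l2 -> l1 < l2.
Proof. by move=> h; rewrite ltNge; apply/negP => /mass_le; rewrite leNgt h. Qed.

(** * Dependence of the multiplier and of the cost on [delta] *)

Section Multiplier.
Variable lambda : R -> R.
Hypothesis massK : {in `]0, 1 - pstar gp gm[, forall delta,
  ftilt_mass (lambda delta) = pstar gp gm + delta}.

Lemma multiplier_gt0 : {in `]0, 1 - pstar gp gm[, forall delta, 0 < lambda delta}.
Proof.
move=> delta hd; apply: mass_lt_inv; rewrite mass0 massK //.
by move: hd; rewrite in_itv /= => /andP[? _]; rewrite ltrDl.
Qed.

Lemma multiplier_homo :
  {in `]0, 1 - pstar gp gm[ &, {homo lambda : d1 d2 / d1 < d2}}.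
Proof. by move=> x y hx hy xy; apply: mass_lt_inv; rewrite !massK // ltrD2l. Qed.

(** The masses at [lambda x - e] and [lambda x + e] strictly enclose [pstar + x]; when [pstar + y]
    also lies between them, strict monotonicity of the mass puts [lambda y] within [e] of
    [lambda x]. *)
Lemma multiplier_continuous : {in `]0, 1 - pstar gp gm[, continuous lambda}.
Proof.
move=> x hx; apply/cvgrPdist_lt => e e0.
have x1 : ftilt_mass (lambda x - e) < pstar gp gm + x.
  by rewrite -massK //; apply: mass_lt; rewrite ltrBlDr ltrDl.
have x2 : pstar gp gm + x < ftilt_mass (lambda x + e).
  by rewrite -massK //; apply: mass_lt; rewrite ltrDl.
have hx' : x \in `]ftilt_mass (lambda x - e) - pstar gp gm,
    ftilt_mass (lambda x + e) - pstar gp gm[.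
  by rewrite in_itv /= ltrBlDl ltrBrDl x1 x2.
near=> y.
have hy : y \in `]0, 1 - pstar gp gm[ by near: y; exact: near_in_itvoo.
have : y \in `]ftilt_mass (lambda x - e) - pstar gp gm,
    ftilt_mass (lambda x + e) - pstar gp gm[ by near: y; exact: near_in_itvoo.
rewrite in_itv /= ltrBlDl ltrBrDl -massK // => /andP[/mass_lt_inv y1 /mass_lt_inv y2].
by rewrite ltr_distlC y1 y2.
Unshelve. all: by end_near. Qed.

Lemma cost_continuous :
  {in `]0, 1 - pstar gp gm[, continuous (fun delta => ftilt_cost (lambda delta))}.
Proof.
move=> x hx; apply/cvgrPdist_le => e e0.
have l0 := multiplier_gt0 hx.
(* By continuity of [lambda], [lambda x + 1] bounds both slopes [lambda x] and [lambda y] near [x],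
   hence the radius. *)
have d0 : 0 < e / (lambda x + 1) by rewrite divr_gt0 // addr_gt0.
near=> y.
have hy : y \in `]0, 1 - pstar gp gm[ by near: y; exact: near_in_itvoo.
have l0' := multiplier_gt0 hy.
have ly : lambda y < lambda x + 1.
  have : `|lambda x - lambda y| < 1.
    by near: y; move/cvgrPdist_lt : (multiplier_continuous hx); apply.
  by rewrite ltr_norml => /andP[]; lra.
have xy : `|x - y| <= e / (lambda x + 1).
  by near: y; exact: (@cvgr_dist_le _ _ _ _ _ id).
have dm a b : pstar gp gm + a - (pstar gp gm + b) = a - b by ring.
have := cost_tangent (lambda x) (lambda y); have := cost_tangent (lambda y) (lambda x).
rewrite !massK // !dm => cyx; rewrite -lerN2 -mulrN !opprB => cxy.
move: xy; rewrite ler_pdivlMr ?addr_gt0 //; apply: le_trans.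
apply: (@norm_le_chord _ _ _ (lambda x) (lambda y)).
- by rewrite ltW //= lerDl.
- by rewrite !ltW.
- by rewrite cyx.
Unshelve. all: by end_near. Qed.

End Multiplier.

(** * The time window and integrability over space-time *)

Variables (T eps t : R).
Hypothesis hT : 0 < T.
Hypothesis heps : 0 < eps < T.
Hypothesis ht : 0 <= t <= T.

Local Notation W := (window T eps t).
Local Notation L := (window_length T eps t).
Local Notation D := (space_time T).
Local Notation D' := (unit_square `*` window T eps t).

Lemma window_itv : W = [set` `[Num.max (t - eps) 0, Num.min (t + eps) T]].
Proof.
rewrite /window; apply/seteqP; split => x.
  move=> [] /=; rewrite !in_itv /= ge_max le_min.
  by move=> /andP[-> ->] /andP[-> ->].
rewrite /= in_itv /= ge_max le_min => /andP[/andP[h1 h2] /andP[h3 h4]].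
by split; rewrite /= in_itv /= ?h1 ?h2 ?h3 ?h4.
Qed.

Lemma measurable_window : measurable (W : set (measurableTypeR R)).
Proof. by rewrite window_itv; exact: measurable_itv. Qed.

(** The window keeps positive length even when [t] is an endpoint of [0, T]. *)
Lemma window_bounds : Num.max (t - eps) 0 < Num.min (t + eps) T.
Proof.
case/andP: heps => e0 eT; case/andP: ht => t0 tT.
by rewrite gt_max !lt_min hT; apply/and3P; split; lra.
Qed.

Lemma leb1_window : leb1 R W = L%:E.
Proof.
by rewrite /window_length window_itv lebesgue_measure_itv /= lte_fin window_bounds.
Qed.

Lemma window_length_gt0 : 0 < L.
Proof.
rewrite -lte_fin -leb1_window window_itv lebesgue_measure_itv /= lte_fin window_bounds.
by rewrite lte_fin subr_gt0 window_bounds.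
Qed.

Lemma measurable_space_time :
  measurable (D : set (measurableTypeR R * measurableTypeR R * measurableTypeR R)).
Proof. by apply: measurableX => //; exact: measurable_itv. Qed.

Lemma measurable_square_window :
  measurable (D' : set (measurableTypeR R * measurableTypeR R * measurableTypeR R)).
Proof. by apply: measurableX => //; exact: measurable_window. Qed.

Hint Extern 0 (measurable (space_time _)) => (exact: measurable_space_time) : core.
Hint Extern 0 (measurable (_ `*` window _ _ _)) => (exact: measurable_square_window) : core.

Lemma leb1_itv0T : leb1 R `[0, T] = T%:E.
Proof. by rewrite lebesgue_measure_itv /= lte_fin hT oppr0 adde0. Qed.

Lemma sub_square_window : D' `<=` D.
Proof. by move=> q [? []]. Qed.

Lemma integrable_cst_space_time r :
  (leb3 R).-integrable D (EFin \o (cst r : R * R * R -> R)).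
Proof.
apply: (integrable_setX_fst (f := cst r)) => //.
- by rewrite [X in (X < _)%E]leb1_itv0T ltry.
- exact: integrable_cst_square.
Qed.

Lemma W0_integrable phi : W0 T phi -> (leb3 R).-integrable D (EFin \o phi).
Proof.
move=> [mphi phi01]; apply: ae_le_integrable (integrable_cst_space_time 1) => //.
by apply: filterS phi01 => q h /h/andP[h0 h1]; rewrite ger0_norm.
Qed.

Lemma measurable_Q1_W0 phi : W0 T phi ->
  measurable_fun D (fun q => Q1 (phi q) (gp q.1) (gm q.1)).
Proof.
move=> [mphi _]; apply: measurable_fun_Q1 => //.
- by apply: (measurable_fun_setX_fst (f := gp)) => //; exact: measurable_itv.
- by apply: (measurable_fun_setX_fst (f := gm)) => //; exact: measurable_itv.
Qed.

Lemma integrable_Q1_W0 phi : W0 T phi -> (leb3 R).-integrable D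
  (EFin \o (fun q => Q1 (phi q) (gp q.1) (gm q.1))).
Proof.
move=> phiW; have [mphi phi01] := phiW.
have ipm : (leb3 R).-integrable D (EFin \o ((fun z => gp z + gm z) \o fst)).
  apply: integrable_setX_fst => //.
  - by rewrite [X in (X < _)%E]leb1_itv0T ltry.
  - exact: (integrableD _ gp_L1 gm_L1).
apply: ae_le_integrable ipm => //; first exact: measurable_Q1_W0.
apply: filterS phi01 => q h Dq; rewrite ger0_norm ?Q1_ge0 //; case: (Dq) => sq _.
by apply: Q1_le; [exact: gp_ge0|exact: gm_ge0|exact: h].
Qed.

(** The cost is finite on all of [W0] because the rates are integrable, so real integrals can be
    used from here on. *)
Lemma objectiveE phi : W0 T phi -> objective gp gm T phi =
  (\int[leb3 R]_(q in space_time T) Q1 (phi q) (gp q.1) (gm q.1))%:E.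
Proof.
move=> phiW; rewrite /Rintegral fineK; last first.
  by apply: integrable_fin_num => //; exact: (integrable_Q1_W0 phiW).
rewrite /objective.
rewrite (Tonelli_setX (leb2 R) (leb1 R)
  (F := fun q => Q1 (phi q) (gp q.1) (gm q.1))) //.
- exact: measurable_Q1_W0.
- by move=> q; exact: Q1_ge0.
Qed.

Lemma rates_gt0_space_time :
  {ae leb3 R, forall q, D q -> 0 < gp q.1 /\ 0 < gm q.1}.
Proof.
have : {ae leb3 R, forall q, unit_square q.1 -> 0 < gp q.1 /\ 0 < gm q.1}.
  exact: (ae_product_fst (leb1 R) rates_gt0).
by apply: filterS => q h [] /h.
Qed.

(** Both branches become tilts, with a slope depending on time, so one tangent inequality covers
    them. *)
Lemma phistarE l (q : R * R * R) : 0 < gp q.1 -> 0 < gm q.1 ->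
  phistar gp gm T eps t l q =
  tilt (gp q.1) (gm q.1) (if q.2 \in W then l else 0).
Proof. by rewrite /phistar; case: ifP => // _ a0 b0; rewrite tilt0. Qed.

Lemma phistar_W0 l : W0 T (phistar gp gm T eps t l).
Proof.
split; last first.
  apply: filterS rates_gt0_space_time => q h /h[a0 b0].
  by rewrite phistarE // tilt_itv ?ltW.
have mC : measurable (`[0, T] `\` W : set (measurableTypeR R)).
  by apply: measurableD; [exact: measurable_itv|exact: measurable_window].
(* Measurability is checked separately inside and outside the window. *)
have -> : D = D' `|` unit_square `*` (`[0, T] `\` W).
  apply/seteqP; split => [q [sq q2]|q [[sq [_ q2]]|[sq [q2 _]]]] //.
  by have [Wq|Wq] := pselect (W q.2); [left|right].
have mD'C : measurable (unit_square `*` (`[0, T] `\` W) :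
    set (measurableTypeR R * measurableTypeR R * measurableTypeR R)).
  exact: measurableX.
apply/measurable_funU => //; split.
- apply: (eq_measurable_fun (ftilt gp gm l \o fst)).
    by move=> q /set_mem[_ Wq]; rewrite /phistar mem_set.
  apply: measurable_fun_setX_fst => //; first exact: measurable_window.
  exact: measurable_ftilt.
- apply: (eq_measurable_fun (wstar gp gm \o fst)).
    by move=> q /set_mem[_ [_ Wq]]; rewrite /phistar memNset.
  apply: measurable_fun_setX_fst => //.
  exact: measurable_wstar.
Qed.

(** * Mass and cost of the candidate optimizer *)

Lemma Rintegral_phistar_window l :
  \int[leb3 R]_(q in D') phistar gp gm T eps t l q = L * ftilt_mass l.
Proof.
transitivity (\int[leb3 R]_(q in D') ftilt gp gm l q.1).
  by apply: eq_Rintegral => q /set_mem[_ Wq]; rewrite /phistar mem_set.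
rewrite /Rintegral (integral_setX_fst (leb2 R) (leb1 R) (f := ftilt gp gm l)) //; last 3 first.
- exact: measurable_window.
- exact: measurable_ftilt.
- by move=> z /(ftilt_itv l)/andP[].
rewrite [X in (_ * X)%E]leb1_window fineM //; first by rewrite mulrC.
by apply: integrable_fin_num => //; exact: integrable_ftilt.
Qed.

(** At w = [wstar] the two terms of [Q1] balance, gp (1 - w) = gm w; times outside the window thus
    cost nothing. *)
Lemma cost0 : \int[leb2 R]_(z in unit_square) Q1 (wstar gp gm z) (gp z) (gm z) = 0.
Proof.
rewrite -[RHS](Rintegral_cst_square 0); apply: ae_eq_Rintegral => //.
- by apply: measurable_fun_Q1 => //; exact: measurable_wstar.
- apply: filterS rates_gt0 => z h /h[a0 b0].
  have ab : gp z + gm z != 0 by rewrite gt_eqF ?addr_gt0.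
  rewrite /Q1 /wstar (_ : gp z * (1 - _) = gm z * (gp z / (gp z + gm z))).
    by rewrite subrr expr0n.
  by field.
Qed.

Lemma objective_phistar l :
  objective gp gm T (phistar gp gm T eps t l) = (L * ftilt_cost l)%:E.
Proof.
have fin0 f : (leb2 R).-integrable unit_square (EFin \o f) ->
    (\int[leb2 R]_(z in unit_square) (f z)%:E =
     (\int[leb2 R]_(z in unit_square) f z)%:E)%E.
  by move=> fi; rewrite /Rintegral fineK //; exact: integrable_fin_num.
rewrite /objective.
(* The inner integral is the constant [ftilt_cost l] on the window and 0 off it. *)
transitivity (\int[leb1 R]_(s in `[0%R, T] `&` W) (cst (ftilt_cost l)%:E s))%E.
  rewrite [RHS]integral_mkcondr; apply: eq_integral => s _.
  rewrite patchE /phistar /=; case: ifPn => sW.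
    by rewrite -fin0 //; exact: integrable_Q1_ftilt.
  rewrite fin0 ?cost0 //.
  apply: integrable_Q1; first exact: measurable_wstar.
  apply: filterS rates_gt0 => z h sz; have [a0 b0] := h sz.
  by rewrite /wstar -tilt0 // tilt_itv ?ltW.
rewrite integral_cst; last first.
  by apply: measurableI; [exact: measurable_itv|exact: measurable_window].
have -> : `[0, T] `&` W = W.
  by apply/seteqP; split => s; [case|move=> ws; split => //; case: ws].
by rewrite [X in (_ * X)%E]leb1_window -EFinM mulrC.
Qed.

(* The multiplier [l] acts on the time window only; [wstar] is the tilt with
   multiplier 0. *)
Definition constraint_term l (phi : R * R * R -> R) (q : R * R * R) :=
  (if q.2 \in W then l else 0) * (phi q - phistar gp gm T eps t l q).

(** Written as a restriction, the term can be integrated over the window instead of all of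
    space-time. *)
Lemma constraint_termE l phi (q : R * R * R) : D q ->
  constraint_term l phi q = l * ((fun q => phi q - phistar gp gm T eps t l q) \_ D') q.
Proof.
move=> [sq _]; rewrite /constraint_term patchE in_setX (mem_set sq) /=.
by case: ifP => // _; rewrite mul0r mulr0.
Qed.

Lemma W0_sub_integrable l phi : W0 T phi -> (leb3 R).-integrable D
  (EFin \o (fun q => phi q - phistar gp gm T eps t l q)).
Proof.
move=> phiW.
by apply: (integrableB _ (W0_integrable phiW) (W0_integrable (phistar_W0 l))).
Qed.

Lemma integrable_constraint_term l phi : W0 T phi ->
  (leb3 R).-integrable D (EFin \o constraint_term l phi).
Proof.
move=> phiW; have i := W0_sub_integrable l phiW.
have i' : (leb3 R).-integrable D
    ((EFin \o (fun q => phi q - phistar gp gm T eps t l q)) \_ D').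
  have DD' : D `&` D' = D' by rewrite setIidr //; exact: sub_square_window.
  have iD' : (leb3 R).-integrable (D `&` D')
      (EFin \o (fun q => phi q - phistar gp gm T eps t l q)).
    by rewrite DD'; apply: integrableS i => //; exact: sub_square_window.
  exact: (proj1 (integrable_restrict _ _ (@measurable_space_time) _) iD').
apply: eq_integrable (integrableZl _ l i') => //= q /set_mem Dq.
by rewrite constraint_termE // !patchE; case: ifP => _ //; rewrite mulr0 mule0.
Qed.

Lemma Rintegral_constraint_term l phi : W0 T phi ->
  \int[leb3 R]_(q in D) constraint_term l phi q =
  l * (\int[leb3 R]_(q in D') phi q - L * ftilt_mass l).
Proof.
move=> phiW; have i := W0_sub_integrable l phiW.
have i1 := W0_integrable phiW.
have i2 := W0_integrable (phistar_W0 l).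
have iS f : (leb3 R).-integrable D f -> (leb3 R).-integrable D' f.
  by apply: integrableS => //; exact: sub_square_window.
rewrite -Rintegral_phistar_window -RintegralB ?iS //.
rewrite -RintegralZl ?iS //.
rewrite -[in RHS](setIidr sub_square_window).
rewrite [RHS]Rintegral_mkcondr; apply: eq_Rintegral => q /set_mem Dq.
by rewrite constraint_termE // !patchE; case: ifP => _ //; rewrite mulr0.
Qed.

(** * The tangent inequality over space-time and its equality case *)

Lemma Q1_phistar_tangent l phi : W0 T phi -> {ae leb3 R, forall q, D q ->
  Q1 (phistar gp gm T eps t l q) (gp q.1) (gm q.1) + constraint_term l phi q <=
  Q1 (phi q) (gp q.1) (gm q.1)}.
Proof.
move=> [_ phi01]; apply: filterS2 rates_gt0_space_time phi01 => q h h' Dq.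
have [[a0 b0] u01] := (h Dq, h' Dq).
by rewrite /constraint_term phistarE //; exact: Q1_tangent.
Qed.

Lemma integrable_tangent l phi : W0 T phi -> (leb3 R).-integrable D (EFin \o (fun q =>
  Q1 (phistar gp gm T eps t l q) (gp q.1) (gm q.1) + constraint_term l phi q)).
Proof.
move=> phiW.
by apply: (integrableD _ (integrable_Q1_W0 (phistar_W0 l))
  (integrable_constraint_term l phiW)).
Qed.

Lemma Rintegral_tangent l phi : W0 T phi ->
  \int[leb3 R]_(q in D)
    (Q1 (phistar gp gm T eps t l q) (gp q.1) (gm q.1) + constraint_term l phi q) =
  L * ftilt_cost l + l * (\int[leb3 R]_(q in D') phi q - L * ftilt_mass l).
Proof.
move=> phiW; rewrite RintegralD //; last 2 first.
- exact: (integrable_Q1_W0 (phistar_W0 l)).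
- exact: integrable_constraint_term.
rewrite Rintegral_constraint_term //; congr (_ + _); apply: EFin_inj.
by rewrite -objective_phistar objectiveE //; exact: phistar_W0.
Qed.

(** Weak Lagrangian duality: a lower bound for the cost that is affine in the mass of [phi] on the
    window. *)
Lemma objective_ge l phi : W0 T phi ->
  ((L * ftilt_cost l + l * (\int[leb3 R]_(q in D') phi q - L * ftilt_mass l))%:E <=
   objective gp gm T phi)%E.
Proof.
move=> phiW; rewrite objectiveE // lee_fin -Rintegral_tangent //.
apply: ae_le_Rintegral => //; [exact: integrable_tangent|exact: integrable_Q1_W0|].
exact: Q1_phistar_tangent.
Qed.

(** Equality of the integrals forces the tangent inequality to be an equality almost everywhere, and
    [Q1_tangent_eq] identifies [phi] there. *)
Lemma objective_eq l phi : W0 T phi ->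
  (objective gp gm T phi <=
   (L * ftilt_cost l + l * (\int[leb3 R]_(q in D') phi q - L * ftilt_mass l))%:E)%E ->
  ae_eq (leb3 R) D phi (phistar gp gm T eps t l).
Proof.
move=> phiW; rewrite objectiveE // lee_fin -Rintegral_tangent // => h.
have e := ae_eq_of_Rintegral_le (@measurable_space_time) (integrable_tangent l phiW)
  (integrable_Q1_W0 phiW) (Q1_phistar_tangent l phiW) h.
have [_ phi01] := phiW.
apply: filterS3 rates_gt0_space_time phi01 e => q h1 h2 h3 Dq.
have [[a0 b0] u01] := (h1 Dq, h2 Dq); have := h3 Dq.
by rewrite /constraint_term phistarE // => /esym; exact: Q1_tangent_eq.
Qed.

Lemma feasibleE delta phi : feasible gp gm T eps t delta phi <->
  W0 T phi /\ L * (pstar gp gm + delta) <= \int[leb3 R]_(q in D') phi q.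
Proof.
split => -[phiW h]; split => //; move: h;
  by rewrite ler_pdivlMl // window_length_gt0.
Qed.

(** * Optimality, uniqueness and value at a given constraint level *)

Section Optimum.
Variables (l delta : R).
Hypothesis l0 : 0 <= l.
Hypothesis mass_l : ftilt_mass l = pstar gp gm + delta.

Lemma phistar_feasible : feasible gp gm T eps t delta (phistar gp gm T eps t l).
Proof.
apply/feasibleE; split; first exact: phistar_W0.
by rewrite Rintegral_phistar_window mass_l.
Qed.

(** With [0 <= l] and the mass of the tilt equal to the required level, the Lagrange term of
    [objective_ge] is nonnegative on feasible functions. *)
Lemma feasible_objective_ge phi : feasible gp gm T eps t delta phi ->
  ((L * ftilt_cost l)%:E <= objective gp gm T phi)%E.
Proof.
move=> /feasibleE[phiW h]; apply: le_trans (objective_ge l phiW).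
by rewrite lee_fin lerDl mulr_ge0 // subr_ge0 mass_l.
Qed.

Lemma phistar_optimizer :
  is_optimizer gp gm T eps t delta (phistar gp gm T eps t l).
Proof.
split; first exact: phistar_feasible.
by move=> psi /feasible_objective_ge; rewrite objective_phistar.
Qed.

Lemma optimizer_unique phi : is_optimizer gp gm T eps t delta phi ->
  ae_eq (leb3 R) D phi (phistar gp gm T eps t l).
Proof.
move=> [/feasibleE[phiW h] /(_ _ phistar_feasible)].
rewrite objective_phistar => h'; apply: objective_eq => //.
(* An optimizer costs at most as much as [phistar], hence at most its own tangent bound, which is
   the equality case. *)
apply: (le_trans h'); rewrite lee_fin lerDl mulr_ge0 // subr_ge0 mass_l //.
Qed.

Lemma optimal_valueE : optimal_value gp gm T eps t delta = (L * ftilt_cost l)%:E.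
Proof.
apply/eqP; rewrite eq_le; apply/andP; split.
  rewrite -objective_phistar; apply: ereal_inf_lbound.
  by exists (phistar gp gm T eps t l) => //; exact: phistar_feasible.
by apply: le_ereal_inf_tmp => _ [phi /feasible_objective_ge ? <-].
Qed.

End Optimum.

End Rates.

Theorem proposition3p24 (R : realType) (T : R) (hT : 0 < T)
  (gp gm : R * R -> R)
  (gp_ge0 : forall z, unit_square z -> 0 <= gp z)
  (gm_ge0 : forall z, unit_square z -> 0 <= gm z)
  (gp_meas : measurable_fun (unit_square) gp)
  (gm_meas : measurable_fun (unit_square) gm)
  (gp_L1 : (leb2 R).-integrable (unit_square) (EFin \o gp))
  (gm_L1 : (leb2 R).-integrable (unit_square) (EFin \o gm))
  (c : R) (hc : 0 < c)
  (gp_ge : {ae leb2 R, forall z, unit_square z -> c <= gp z})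
  (gm_ge : {ae leb2 R, forall z, unit_square z -> c <= gm z}) :
  exists lambda : R -> R,
  [/\ {in `]0, 1 - pstar gp gm[, forall delta,
        \int[leb2 R]_(z in unit_square) ftilt gp gm (lambda delta) z
          = pstar gp gm + delta /\
        forall l, \int[leb2 R]_(z in unit_square) ftilt gp gm l z
          = pstar gp gm + delta -> l = lambda delta},
      {in `]0, 1 - pstar gp gm[ &, {homo lambda : d1 d2 / d1 < d2}},
      {in `]0, 1 - pstar gp gm[, continuous lambda} &
      forall eps t : R, eps \in `]0, T[ -> t \in `[0, T] ->
        let value delta := window_length T eps t *
          \int[leb2 R]_(z in unit_square)
            Q1 (ftilt gp gm (lambda delta) z) (gp z) (gm z) in
        {in `]0, 1 - pstar gp gm[, forall delta,
          [/\ is_optimizer gp gm T eps t delta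
                (phistar gp gm T eps t (lambda delta)),
              forall phi, is_optimizer gp gm T eps t delta phi ->
                ae_eq (leb3 R) (space_time T) phi
                  (phistar gp gm T eps t (lambda delta)) &
              optimal_value gp gm T eps t delta = (value delta)%:E]} /\
        {in `]0, 1 - pstar gp gm[, continuous value}].
Proof.
have surj delta : delta \in `]0, 1 - pstar gp gm[ ->
    exists l, ftilt_mass gp gm l = pstar gp gm + delta.
  rewrite in_itv /= => /andP[d0 d1].
  apply: (mass_surj gp_ge0 gm_ge0 gp_meas gm_meas gm_L1 hc gp_ge gm_ge).
  by apply/andP; split; lra.
(* The default 0 is taken only where no solution exists, so never for [delta] in the open
   interval. *)
pose lambda delta := xget 0 [set l | ftilt_mass gp gm l = pstar gp gm + delta].
have massK : {in `]0, 1 - pstar gp gm[, forall delta,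
    ftilt_mass gp gm (lambda delta) = pstar gp gm + delta}.
  move=> delta /surj[l ml].
  exact: (xgetI 0 (P := [set l | ftilt_mass gp gm l = pstar gp gm + delta]) ml).
exists lambda; split.
- move=> delta hd; split; first exact: massK.
  move=> l; rewrite -[LHS]/(ftilt_mass gp gm l) -(massK _ hd) => ml.
  by have [h|h|//] := ltgtP l (lambda delta); have := mass_lt gp_ge0 gm_ge0
    gp_meas gm_meas hc gp_ge gm_ge h; rewrite ml ltxx.
- exact: (multiplier_homo gp_ge0 gm_ge0 gp_meas gm_meas hc gp_ge gm_ge massK).
- exact: (multiplier_continuous gp_ge0 gm_ge0 gp_meas gm_meas hc gp_ge gm_ge massK).
move=> eps t; rewrite !in_itv /= => heps ht; split.
- move=> delta hd.
  have l0 : 0 <= lambda delta.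
    by apply: ltW; apply: (multiplier_gt0 gp_ge0 gm_ge0 gp_meas gm_meas hc gp_ge gm_ge massK).
  split.
  + exact: (phistar_optimizer gp_ge0 gm_ge0 gp_meas gm_meas
      gp_L1 gm_L1 hc gp_ge gm_ge hT heps ht l0 (massK _ hd)).
  + move=> phi; exact: (optimizer_unique gp_ge0 gm_ge0 gp_meas gm_meas
      gp_L1 gm_L1 hc gp_ge gm_ge hT heps ht l0 (massK _ hd)).
  + exact: (optimal_valueE gp_ge0 gm_ge0 gp_meas gm_meas
      gp_L1 gm_L1 hc gp_ge gm_ge hT heps ht l0 (massK _ hd)).
- move=> x hx; apply: cvgMr.
  exact: (cost_continuous gp_ge0 gm_ge0 gp_meas gm_meas gp_L1 gm_L1 hc gp_ge gm_ge massK).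
Qed.
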